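(* Let $\mathfrak{F}$ be a perfect stable right Gabriel topology on a ring $R$, and consider a commutative diagram of right $R$-modules and right $R$-module morphisms with $\mathfrak{F}$-exact rows $A_1 \xrightarrow{f_1} A_2 \xrightarrow{f_2} A_3 \xrightarrow{f_3} A_4$ and $B_1 \xrightarrow{g_1} B_2 \xrightarrow{g_2} B_3 \xrightarrow{g_3} B_4$ and vertical morphisms $t_i\colon A_i\to B_i$ ($i=1,2,3,4$), so that $t_{i+1}f_i=g_it_i$ for $i=1,2,3$. (1) If $t_1,t_3$ are $\mathfrak{F}$-epis, $t_4$ is monic and $B_2$ is $\mathfrak{F}$-torsionfree, then $t_2$ is $\mathfrak{F}$-epi. (2) If $t_1$ is $\mathfrak{F}$-epi and $t_2,t_4$ are monic, then $\ker(t_3)$ is an $\mathfrak{F}$-torsion $R$-module. In particular, if $A_3$ is an $\mathfrak{F}$-torsionfree $R$-module, then $t_3$ is monic.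
   Context: Rings are associative with identity $1\neq 0$, not necessarily commutative; modules are unitary right modules. A right Gabriel topology $\mathfrak{F}$ on $R$ is a nonempty family of right ideals of $R$ closed under finite intersections and under passing to larger right ideals, such that $(I:r)=\{s\in R\mid rs\in I\}\in\mathfrak{F}$ whenever $I\in\mathfrak{F}$, $r\in R$, and such that a right ideal $J$ belongs to $\mathfrak{F}$ whenever there is $I\in\mathfrak{F}$ with $(J:r)\in\mathfrak{F}$ for all $r\in I$. A right $R$-module $M$ is $\mathfrak{F}$-torsion if every $x\in M$ is annihilated by some $I\in\mathfrak{F}$ ($xI=0$), and $\mathfrak{F}$-torsionfree if $0$ is its only element annihilated by some $I\in\mathfrak{F}$. $\mathfrak{F}$ is stable if the class of $\mathfrak{F}$-torsion modules is closed under injective envelopes. For stable $\mathfrak{F}$ put $M_{\mathfrak{F}}=\varinjlim_{I\in\mathfrak{F}}\mathrm{Hom}_R(I,M)$ (transition maps are restrictions); $R_{\mathfrak{F}}$ is a ring and $M\mapsto M_{\mathfrak{F}}$ is a left exact functor $\mathrm{Mod}\text{-}R\to\mathrm{Mod}\text{-}R_{\mathfrak{F}}$, where the product of the classes of $x\colon I\to M$ and $a\colon J\to R$ is the class of $x\circ a$ restricted to $a^{-1}(I)$. $\mathfrak{F}$ is perfect if the functors $(-)_{\mathfrak{F}}$ and $-\otimes_R R_{\mathfrak{F}}$ are naturally isomorphic (via the canonical map $M\otimes_R R_{\mathfrak{F}}\to M_{\mathfrak{F}}$); then $R_{\mathfrak{F}}$ is flat as a left $R$-module. A cochain complex $\cdots\to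 M^{i-1}\xrightarrow{f^{i-1}}M^i\xrightarrow{f^i}M^{i+1}\to\cdots$ of right $R$-modules is $\mathfrak{F}$-exact if $\ker(f^i)/f^{i-1}(M^{i-1})$ is $\mathfrak{F}$-torsion for every $i$; for a finite row the condition is imposed at every term having both an incoming and an outgoing map in the row. A morphism $f\colon A\to B$ is $\mathfrak{F}$-epi if $B/f(A)$ is $\mathfrak{F}$-torsion. *)

(* Defs.v *)
From HB Require Import structures.
From mathcomp Require Import all_boot all_order all_algebra.
From mathcomp Require Import boolp classical_sets.
From mathcomp Require Import freeg.

Set Implicit Arguments.
Unset Strict Implicit.
Unset Printing Implicit Defensive.

Import GRing.Theory.

Local Open Scope classical_set_scope.
Local Open Scope ring_scope.
Local Open Scope quotient_scope.

(* A right R-module is a left module over the converse ring R^c: for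
   m : M : lmodType R^c and r : R, the element (r : R^c) *: m is m r.
   In particular (R^c)^o is R as a right module over itself. *)

Section QuotientModule.
Variables (K : pzRingType) (M : lmodType K) (N : submodClosed M).

(* submodClosed does not declare closure under opposites, which is needed for
   the quotient group and follows from scaling by -1. *)
Definition submod_pred : {pred M} := fun x => x \in N.

Lemma submod_pred_zmod : zmod_closed submod_pred.
Proof.
split=> [|x y xN yN]; first exact: (rpred0 N).
by rewrite -scaleN1r; exact: (rpredD xN (rpredZ (-1) yN)).
Qed.

HB.instance Definition _ :=
  GRing.isZmodClosed.Build M submod_pred submod_pred_zmod.

Definition quotmod := Quotient.quot submod_pred.

HB.instance Definition _ := GRing.Zmodule.on quotmod.
HB.instance Definition _ :
    ZmodQuotient M (Quotient.equiv submod_pred) 0 -%R +%R quotmod :=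
  ZmodQuotient.on quotmod.

Definition quotmod_scale (a : K) (x : quotmod) : quotmod :=
  \pi_quotmod (a *: repr x).

Lemma quotmod_eqP (x y : M) :
  reflect (\pi_quotmod x = \pi_quotmod y) (x - y \in N).
Proof.
rewrite -[_ \in N]/(x - y \in submod_pred) Quotient.idealrBE.
exact: eqP.
Qed.

Lemma pi_quotmod_scale (a : K) (x : M) :
  quotmod_scale a (\pi_quotmod x) = \pi_quotmod (a *: x).
Proof.
apply/quotmod_eqP; rewrite -scalerBr rpredZ //.
by apply/quotmod_eqP; rewrite reprK.
Qed.

Lemma quotmod_scaleA (a b : K) (x : quotmod) :
  quotmod_scale a (quotmod_scale b x) = quotmod_scale (a * b) x.
Proof. by rewrite pi_quotmod_scale scalerA. Qed.

Lemma quotmod_scale1 : left_id 1 quotmod_scale.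
Proof. by move=> x; rewrite -[x]reprK pi_quotmod_scale scale1r. Qed.

Lemma quotmod_scaleDr : right_distributive quotmod_scale +%R.
Proof.
move=> a x y; rewrite -[x]reprK -[y]reprK.
by rewrite -[_ + _ in LHS]Quotient.pi_add !pi_quotmod_scale scalerDr raddfD.
Qed.

Lemma quotmod_scaleDl (x : quotmod) :
  {morph quotmod_scale^~ x : a b / a + b}.
Proof.
by move=> a b; rewrite /quotmod_scale scalerDl raddfD.
Qed.

HB.instance Definition _ := GRing.Zmodule_isLmodule.Build K quotmod
  quotmod_scaleA quotmod_scale1 quotmod_scaleDr quotmod_scaleDl.

End QuotientModule.

Section LinearMaps.
Variables (K : pzRingType) (A B : lmodType K) (f : {linear A -> B}).

Definition in_ker : {pred A} := fun x => f x == 0.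
Definition in_im : {pred B} := fun y => `[< exists x, f x = y >].

Lemma in_ker_submod : submod_closed in_ker.
Proof.
split=> [|a x y]; rewrite !unfold_in ?raddf0 // => /eqP fx /eqP fy.
by rewrite linearP fx fy scaler0 addr0.
Qed.

Lemma in_im_submod : submod_closed in_im.
Proof.
split=> [|a x y]; first by apply/asboolP; exists 0; rewrite raddf0.
move=> /asboolP[u <-] /asboolP[v <-]; apply/asboolP.
by exists (a *: u + v); rewrite linearP.
Qed.

HB.instance Definition _ := GRing.isSubmodClosed.Build K A in_ker in_ker_submod.
HB.instance Definition _ := GRing.isSubmodClosed.Build K B in_im in_im_submod.

Record kermod := Kermod { kermod_val :> A; kermod_valP : kermod_val \in in_ker }.

HB.instance Definition _ := [isSub for kermod_val].
HB.instance Definition _ := [Choice of kermod by <:].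
HB.instance Definition _ := [SubChoice_isSubLmodule of kermod by <:].

Definition cokermod := quotmod in_im.

HB.instance Definition _ := GRing.Lmodule.on cokermod.

End LinearMaps.

Section Homology.
Variables (K : pzRingType) (A B C : lmodType K).
Variables (f : {linear A -> B}) (g : {linear B -> C}).

(* The submodule of ker g to be factored out is im f, restricted to ker g so
   that the definition makes sense without assuming g \o f = 0. *)
Definition in_im_ker : {pred kermod g} := fun x => val x \in in_im f.

Lemma in_im_ker_submod : submod_closed in_im_ker.
Proof.
split=> [|a x y fx fy].
  by rewrite -[_ \in _]/(val 0 \in in_im f) raddf0; exact: (rpred0 (in_im f)).
rewrite -[_ \in _]/(val (a *: x + y) \in in_im f) linearP.
exact: (rpredD (rpredZ a (fx : val x \in in_im f)) fy).
Qed.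

HB.instance Definition _ :=
  GRing.isSubmodClosed.Build K (kermod g) in_im_ker in_im_ker_submod.

Definition homology := quotmod in_im_ker.

HB.instance Definition _ := GRing.Lmodule.on homology.

End Homology.

Definition right_ideal (R : nzRingType) (I : set R) : Prop :=
  [/\ I 0, forall x y, I x -> I y -> I (x + y) & forall x r, I x -> I (x * r)].

Record gabriel_topology (R : nzRingType) := GabrielTopology {
  gabriel_mem :> set R -> Prop;
  gabriel_right_ideal : forall I, gabriel_mem I -> right_ideal I;
  gabriel_nonempty : exists I, gabriel_mem I;
  gabriel_setI : forall I J,
    gabriel_mem I -> gabriel_mem J -> gabriel_mem (I `&` J);
  gabriel_sub : forall I J,
    gabriel_mem I -> right_ideal J -> I `<=` J -> gabriel_mem J;
  gabriel_colon : forall I r,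
    gabriel_mem I -> gabriel_mem [set s | I (r * s)];
  gabriel_local : forall I J, right_ideal J -> gabriel_mem I ->
    (forall r, I r -> gabriel_mem [set s | J (r * s)]) -> gabriel_mem J
}.

Section Torsion.
Variables (R : nzRingType) (F : gabriel_topology R).

Definition annihilated (M : lmodType R^c) (x : M) : Prop :=
  exists2 I, F I & forall r : R, I r -> (r : R^c) *: x = 0.

Definition torsion (M : lmodType R^c) : Prop := forall x : M, annihilated x.

Definition torsionfree (M : lmodType R^c) : Prop :=
  forall x : M, annihilated x -> x = 0.

Definition Fexact (A B C : lmodType R^c)
    (f : {linear A -> B}) (g : {linear B -> C}) : Prop :=
  (forall x, g (f x) = 0) /\ torsion (homology f g).

Definition Fepi (A B : lmodType R^c) (f : {linear A -> B}) : Prop :=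
  torsion (cokermod f).

End Torsion.

Definition injective_module (K : pzRingType) (E : lmodType K) : Prop :=
  forall (A B : lmodType K) (i : {linear A -> B}) (f : {linear A -> E}),
    injective i -> exists g : {linear B -> E}, forall x, g (i x) = f x.

(* The last condition says that the image of i is essential in E. *)
Definition injective_envelope (K : pzRingType) (M E : lmodType K)
    (i : {linear M -> E}) : Prop :=
  [/\ injective i, injective_module E &
      forall N : submodClosed E,
        (forall y, y \in N -> y \in in_im i -> y = 0) ->
        forall y, y \in N -> y = 0].

Definition stable (R : nzRingType) (F : gabriel_topology R) : Prop :=
  forall (M E : lmodType R^c) (i : {linear M -> E}),
    torsion F M -> injective_envelope i -> torsion F E.

Section GabrielFacts.
Variables (R : nzRingType) (F : gabriel_topology R).

Lemma gabriel_setT : F setT.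
Proof. by have [I FI] := gabriel_nonempty F; apply: gabriel_sub FI _ _. Qed.

End GabrielFacts.

Section Localization.
Variables (R : nzRingType) (F : gabriel_topology R).

(* An R-linear map I -> M with I in F, given by a function on R whose values
   outside I are irrelevant: loc_eq identifies two maps as soon as they agree
   on some member of F contained in both domains. *)
Record partial_hom (M : lmodType R^c) := PartialHom {
  phdom : set R;
  phfun :> R -> M;
  phdomP : F phdom;
  phfunD : forall x y, phdom x -> phdom y -> phfun (x + y) = phfun x + phfun y;
  phfunZ : forall x r, phdom x -> phfun (x * r) = (r : R^c) *: phfun x
}.

HB.instance Definition _ M := gen_eqMixin (partial_hom M).
HB.instance Definition _ M := gen_choiceMixin (partial_hom M).

Lemma phdom_ideal (M : lmodType R^c) (x : partial_hom M) : right_ideal (phdom x).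
Proof. exact: gabriel_right_ideal (phdomP x). Qed.

Lemma phfun0 (M : lmodType R^c) (x : partial_hom M) : x 0 = 0.
Proof.
have [x0 _ _] := phdom_ideal x.
by rewrite -[X in x X](mulr0 0) phfunZ // scale0r.
Qed.

Section LocGroup.
Variable M : lmodType R^c.
Implicit Types x y z : partial_hom M.

Definition loc_eq : rel (partial_hom M) := fun x y =>
  `[< exists K, [/\ F K, K `<=` phdom x, K `<=` phdom y &
                    forall r, K r -> x r = y r] >].

Lemma loc_eq_equiv : equiv_class_of loc_eq.
Proof.
split.
- by move=> x; apply/asboolP; exists (phdom x); split=> //; exact: phdomP.
- move=> x y; apply/idP/idP => /asboolP[K [FK Kx Ky e]];
    by apply/asboolP; exists K; split=> // r /e.
- move=> y x z /asboolP[K [FK Kx Ky e]] /asboolP[L [FL Ly Lz e']].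
  apply/asboolP; exists (K `&` L); split; first exact: gabriel_setI.
  + by move=> r [/Kx].
  + by move=> r [_ /Lz].
  + by move=> r [/e-> /e'].
Qed.

Canonical loc_eq_canonical := EquivRelPack loc_eq_equiv.
Canonical loc_eq_encModRel := defaultEncModRel loc_eq.

(* M_F, the direct limit of the groups Hom_R(I, M) for I in F. *)
Definition loc : Type := {eq_quot loc_eq}.

HB.instance Definition _ : EqQuotient _ loc_eq loc := EqQuotient.on loc.
HB.instance Definition _ := Choice.on loc.

Lemma loc_eqP x y : reflect (\pi_loc x = \pi_loc y) (loc_eq x y).
Proof. by apply: (iffP idP) => [h|/eqmodP//]; apply/eqmodP. Qed.

Lemma loc_ind (P : loc -> Prop) : (forall x, P (\pi_loc x)) -> forall u, P u.
Proof. by move=> h u; rewrite -[u]reprK. Qed.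

Lemma repr_loc_eq x : loc_eq (repr (\pi_loc x)) x.
Proof. by apply/loc_eqP; rewrite reprK. Qed.

Lemma loc_eq_all x y :
  (forall r, phdom x r <-> phdom y r) -> (forall r, x r = y r) -> loc_eq x y.
Proof.
move=> d e; apply/asboolP; exists (phdom x); split=> // [|r /d//].
exact: phdomP.
Qed.

(* m |-> (r |-> m r), of domain R *)
Program Definition ph_const (m : M) : partial_hom M :=
  @PartialHom M setT (fun r => (r : R^c) *: m) (gabriel_setT F) _ _.
Next Obligation. by rewrite -scalerDl. Qed.
Next Obligation. by rewrite scalerA. Qed.

Program Definition ph_add x y : partial_hom M :=
  @PartialHom M (phdom x `&` phdom y) (fun r => x r + y r)
    (gabriel_setI (phdomP x) (phdomP y)) _ _.
Next Obligation. by rewrite /= !phfunD // addrACA. Qed.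
Next Obligation. by rewrite /= !phfunZ // scalerDr. Qed.

Program Definition ph_opp x : partial_hom M :=
  @PartialHom M (phdom x) (fun r => - x r) (phdomP x) _ _.
Next Obligation. by rewrite phfunD // opprD. Qed.
Next Obligation. by rewrite phfunZ // scalerN. Qed.

Lemma ph_add_eq x x' y y' :
  loc_eq x x' -> loc_eq y y' -> loc_eq (ph_add x y) (ph_add x' y').
Proof.
move=> /asboolP[K [FK Kx Kx' e]] /asboolP[L [FL Ly Ly' e']].
apply/asboolP; exists (K `&` L); split; first exact: gabriel_setI.
- by move=> r [/Kx ? /Ly ?]; split.
- by move=> r [/Kx' ? /Ly' ?]; split.
- by move=> r [/e h /e' h']; rewrite /= h h'.
Qed.

Lemma ph_opp_eq x x' : loc_eq x x' -> loc_eq (ph_opp x) (ph_opp x').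
Proof.
move=> /asboolP[K [FK Kx Kx' e]]; apply/asboolP; exists K; split=> //.
by move=> r /e h; rewrite /= h.
Qed.

Definition loc_in (m : M) : loc := \pi_loc (ph_const m).
Definition loc_add (u v : loc) : loc := \pi_loc (ph_add (repr u) (repr v)).
Definition loc_opp (u : loc) : loc := \pi_loc (ph_opp (repr u)).

Lemma pi_loc_add x y : loc_add (\pi_loc x) (\pi_loc y) = \pi_loc (ph_add x y).
Proof. by apply/loc_eqP; apply: ph_add_eq; exact: repr_loc_eq. Qed.

Lemma pi_loc_opp x : loc_opp (\pi_loc x) = \pi_loc (ph_opp x).
Proof. by apply/loc_eqP; apply: ph_opp_eq; exact: repr_loc_eq. Qed.

Lemma loc_addA : associative loc_add.
Proof.
elim/loc_ind=> x; elim/loc_ind=> y; elim/loc_ind=> z.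
rewrite (pi_loc_add y z) (pi_loc_add x y) !pi_loc_add.
apply/loc_eqP/loc_eq_all => r /=; last by rewrite addrA.
by rewrite /setI /=; tauto.
Qed.

Lemma loc_addC : commutative loc_add.
Proof.
elim/loc_ind=> x; elim/loc_ind=> y; rewrite !pi_loc_add.
apply/loc_eqP/loc_eq_all => r /=; last by rewrite addrC.
by rewrite /setI /=; tauto.
Qed.

Lemma loc_add0 : left_id (loc_in 0) loc_add.
Proof.
elim/loc_ind=> x; rewrite pi_loc_add.
apply/loc_eqP/loc_eq_all => r /=; last by rewrite scaler0 add0r.
by split=> [[]|].
Qed.

Lemma loc_addN : left_inverse (loc_in 0) loc_opp loc_add.
Proof.
elim/loc_ind=> x; rewrite pi_loc_opp pi_loc_add.
apply/loc_eqP/asboolP; exists (phdom x); split=> //.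
- exact: phdomP.
- by move=> r _ /=; rewrite scaler0 addNr.
Qed.

HB.instance Definition _ :=
  GRing.isZmodule.Build loc loc_addA loc_addC loc_add0 loc_addN.

Lemma loc_addE x y : \pi_loc x + \pi_loc y = \pi_loc (ph_add x y) :> loc.
Proof. exact: pi_loc_add. Qed.

End LocGroup.

(* The product of the class of x : I -> M and the class of a : J -> R is the
   class of x \o a on a^-1(I). *)
Section LocProduct.
Variable M : lmodType R^c.
Implicit Types (x y : partial_hom M) (a b : partial_hom (R^c)^o).

Lemma preim_gabriel (I : set R) a :
  F I -> F [set r | phdom a r /\ I (a r)].
Proof.
move=> FI; have [I0 ID IM] := gabriel_right_ideal FI.
have [J0 JD JM] := phdom_ideal a.
apply: (gabriel_local (I := phdom a)) (phdomP a) _.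
  split=> [|r s [ar Ir] [as_ Is]|r s [ar Ir]] /=.
  - by rewrite phfun0.
  - by split; [exact: JD | rewrite phfunD //; exact: ID].
  - by split; [exact: JM | rewrite phfunZ //; exact: IM].
move=> r ar; apply: gabriel_sub (gabriel_colon (a r : R) FI) _ _.
  split=> [|s t [ars Is] [art It]|s t [ars Is]] /=.
  - by rewrite mulr0; rewrite phfun0.
  - by rewrite mulrDr; split; [exact: JD | rewrite phfunD //; exact: ID].
  - by rewrite mulrA; split; [exact: JM | rewrite phfunZ //; exact: IM].
by move=> s /= Is; split; [exact: JM | rewrite phfunZ].
Qed.

Program Definition ph_mul x a : partial_hom M :=
  @PartialHom M [set r | phdom a r /\ phdom x (a r)] (fun r => x (a r))
    (preim_gabriel a (phdomP x)) _ _.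
Next Obligation. by rewrite phfunD // phfunD. Qed.
Next Obligation. by rewrite phfunZ // -[RHS]phfunZ. Qed.

Lemma ph_mul_eq x x' a a' :
  loc_eq x x' -> loc_eq a a' -> loc_eq (ph_mul x a) (ph_mul x' a').
Proof.
move=> /asboolP[K [FK Kx Kx' e]] /asboolP[L [FL La La' e']].
apply/asboolP; exists (L `&` [set r | phdom a r /\ K (a r)]); split.
- by apply: gabriel_setI => //; exact: preim_gabriel.
- by move=> r [_ [ar /Kx]].
- by move=> r [Lr [ar Kar]]; split; [exact: La' | rewrite -e' //; exact: Kx'].
- by move=> r [Lr [ar Kar]] /=; rewrite -e' // e.
Qed.

Definition loc_mul (u : loc M) (q : loc (R^c)^o) : loc M :=
  \pi_(loc M) (ph_mul (repr u) (repr q)).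

Lemma pi_loc_mul x a :
  loc_mul (\pi_(loc M) x) (\pi_(loc (R^c)^o) a) = \pi_(loc M) (ph_mul x a).
Proof. by apply/loc_eqP; apply: ph_mul_eq; exact: repr_loc_eq. Qed.

Lemma loc_mulDl (u v : loc M) q :
  loc_mul (u + v) q = loc_mul u q + loc_mul v q.
Proof.
elim/loc_ind: u => x; elim/loc_ind: v => y; elim/loc_ind: q => a.
rewrite loc_addE (pi_loc_mul x a) (pi_loc_mul y a) pi_loc_mul loc_addE.
apply/loc_eqP/loc_eq_all => r //=.
by rewrite /setI /=; tauto.
Qed.

Lemma loc_mulDr (u : loc M) p q :
  loc_mul u (p + q) = loc_mul u p + loc_mul u q.
Proof.
elim/loc_ind: u => x; elim/loc_ind: p => a; elim/loc_ind: q => b.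
rewrite loc_addE (pi_loc_mul x a) (pi_loc_mul x b) pi_loc_mul loc_addE.
have [x0 xD xM] := phdom_ideal x.
apply/loc_eqP/asboolP; exists (phdom (ph_add (ph_mul x a) (ph_mul x b))).
split=> //; first exact: phdomP.
- by move=> r [[ar xr] [br yr]]; split=> //; exact: xD.
- by move=> r [[ar xr] [br yr]]; exact: phfunD.
Qed.

Definition loc_one : loc (R^c)^o := loc_in (1 : (R^c)^o).

Lemma loc_mul1 (u : loc M) : loc_mul u loc_one = u.
Proof.
elim/loc_ind: u => x; rewrite pi_loc_mul; apply/loc_eqP/loc_eq_all => r /=.
  by rewrite [_ *: _]mul1r; split=> [[]|].
by rewrite [_ *: _]mul1r.
Qed.

End LocProduct.

Lemma loc_mulA (M : lmodType R^c) (u : loc M) p q :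
  loc_mul (loc_mul u p) q = loc_mul u (loc_mul p q).
Proof.
elim/loc_ind: u => x; elim/loc_ind: p => a; elim/loc_ind: q => b.
rewrite (pi_loc_mul x a) (pi_loc_mul a b) !pi_loc_mul.
apply/loc_eqP/loc_eq_all => r //=.
by rewrite /setI /=; tauto.
Qed.

Lemma loc_1mul q : loc_mul loc_one q = q.
Proof.
elim/loc_ind: q => a; rewrite pi_loc_mul; apply/loc_eqP/loc_eq_all => r /=.
  by split=> [[]|].
by rewrite [_ *: _]mul1r.
Qed.

(* The ring R_F; it is the zero ring when the zero ideal belongs to F. *)
Definition loc_ring : Type := loc (R^c)^o.

HB.instance Definition _ := GRing.Zmodule.on loc_ring.
HB.instance Definition _ := GRing.Zmodule_isPzRing.Build loc_ring
  (fun p q r => esym (loc_mulA p q r)) loc_1mul (@loc_mul1 _)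
  (@loc_mulDl _) (@loc_mulDr _).

Lemma loc_in_mul (M : lmodType R^c) (m : M) (r : R) :
  loc_mul (loc_in m) (loc_in (r : (R^c)^o)) = loc_in ((r : R^c) *: m).
Proof.
rewrite pi_loc_mul; apply/loc_eqP/loc_eq_all => s //=.
by rewrite scalerA.
Qed.

Lemma loc_inD (M : lmodType R^c) : {morph @loc_in M : m n / m + n}.
Proof.
move=> m n; rewrite loc_addE; apply/loc_eqP/loc_eq_all => s //=.
by rewrite scalerDr.
Qed.

Section LocModule.
Variable M : lmodType R^c.

Definition loc_scale (q : loc_ring^c) (u : loc M) : loc M := loc_mul u q.

Lemma loc_scaleA (p q : loc_ring^c) u :
  loc_scale p (loc_scale q u) = loc_scale (p * q) u.
Proof. exact: loc_mulA. Qed.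

HB.instance Definition _ := GRing.Zmodule_isLmodule.Build loc_ring^c (loc M)
  loc_scaleA (@loc_mul1 M) (fun q u v => loc_mulDl u v q)
  (fun u p q => loc_mulDr u p q).

End LocModule.

(* R_F as a left R-module, along the ring morphism loc_in : R -> R_F. *)
Definition loc_lscale (r : R) (q : loc_ring) : loc_ring :=
  (loc_in (r : (R^c)^o) : loc_ring) * q.

Lemma loc_lscaleA r s q :
  loc_lscale r (loc_lscale s q) = loc_lscale (r * s) q.
Proof. by rewrite /loc_lscale mulrA; congr (_ * _); exact: loc_in_mul. Qed.

Lemma loc_lscaleDl q : {morph loc_lscale^~ q : r s / r + s}.
Proof. by move=> r s; rewrite /loc_lscale [X in X * _]loc_inD mulrDl. Qed.

HB.instance Definition _ := GRing.Zmodule_isLmodule.Build R loc_ring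
  loc_lscaleA (@mul1r _) (fun r p q => mulrDr _ p q) loc_lscaleDl.

End Localization.

Section Tensor.
Variables (R : nzRingType) (M : lmodType R^c) (N : lmodType R).

Definition balanced_relations : set {freeg (M * N)} :=
  [set z | [\/ exists m m' n, z = << (m + m', n) >> - << (m, n) >> - << (m', n) >>,
               exists m n n', z = << (m, n + n') >> - << (m, n) >> - << (m, n') >> |
               exists m (r : R) n,
                 z = << ((r : R^c) *: m, n) >> - << (m, r *: n) >>]].

Definition in_span_relations : {pred {freeg (M * N)}} := fun z =>
  `[< forall G : zmodClosed {freeg (M * N)},
        (forall y, balanced_relations y -> y \in G) -> z \in G >].

Lemma in_span_relations_zmod : zmod_closed in_span_relations.
Proof.
split=> [|x y /asboolP hx /asboolP hy]; apply/asboolP => G hG.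
  exact: rpred0.
by rewrite rpredB ?hx ?hy.
Qed.

HB.instance Definition _ := GRing.isZmodClosed.Build {freeg (M * N)}
  in_span_relations in_span_relations_zmod.

Definition tensor : Type := Quotient.quot in_span_relations.

HB.instance Definition _ := GRing.Zmodule.on tensor.
HB.instance Definition _ :
    ZmodQuotient _ (Quotient.equiv in_span_relations) 0 -%R +%R tensor :=
  ZmodQuotient.on tensor.

Definition tens (m : M) (n : N) : tensor := \pi_tensor << (m, n) >>.

End Tensor.

Section Perfect.
Variables (R : nzRingType) (F : gabriel_topology R).
Variable M : lmodType R^c.

Local Notation RF := (loc_ring F).

(* m (x) q |-> m q, first on the free abelian group, then on the quotient *)
Definition canonical_free (z : {freeg (M * RF)}) : loc F M :=
  fglift (fun mq => (mq.2 : RF^c) *: loc_in F mq.1 : zmodule (loc F M)) z.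

Definition canonical_map (t : tensor M RF) : loc F M := canonical_free (repr t).

Lemma canonical_free_additive : zmod_morphism canonical_free.
Proof.
move=> x y.
exact: (@lift_is_additive int (M * RF)%type (zmodule (loc F M)) _ x y).
Qed.

HB.instance Definition _ := GRing.isZmodMorphism.Build _ _
  canonical_free canonical_free_additive.

Lemma canonical_free1 m (q : RF) :
  canonical_free << (m, q) >> = (q : RF^c) *: loc_in F m.
Proof. by rewrite /canonical_free liftU scale1r. Qed.

Definition canonical_free_ker : {pred {freeg (M * RF)}} :=
  fun z => canonical_free z == 0.

Lemma canonical_free_ker_zmod : zmod_closed canonical_free_ker.
Proof.
split=> [|x y]; rewrite !unfold_in ?raddf0 // => /eqP hx /eqP hy.
by rewrite raddfB /= hx hy subr0.
Qed.

HB.instance Definition _ := GRing.isZmodClosed.Build {freeg (M * RF)}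
  canonical_free_ker canonical_free_ker_zmod.

Lemma canonical_free_span z : in_span_relations z -> canonical_free z = 0.
Proof.
move=> /asboolP h; apply/eqP; apply: (h canonical_free_ker) => {h z} y.
rewrite unfold_in; case=> [[m [m' [n ->]]]|[m [n [n' ->]]]|[m [r [n ->]]]];
  rewrite !raddfB /= !canonical_free1 /=.
- by rewrite loc_inD scalerDr addrAC addrK subrr.
- by rewrite [X in X - _ - _]scalerDl addrAC addrK subrr.
- by rewrite subr_eq0 -loc_in_mul; apply/eqP; exact: loc_mulA.
Qed.

Lemma pi_canonical_map z : canonical_map (\pi_(tensor M RF) z) = canonical_free z.
Proof.
apply/eqP; rewrite -subr_eq0 -[canonical_map _]/(canonical_free _) -raddfB; apply/eqP; apply: canonical_free_span.
suff: repr (\pi_(tensor M RF) z) - z \in @in_span_relations R M RF by [].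
by rewrite Quotient.idealrBE; apply/eqP; exact: reprK.
Qed.

Lemma canonical_mapD : {morph canonical_map : s t / s + t}.
Proof.
move=> s t; rewrite -[s]reprK -[t]reprK -pi_addr !pi_canonical_map.
exact: raddfD.
Qed.

Lemma canonical_map_tens m (q : RF) :
  canonical_map (tens m q) = (q : RF^c) *: loc_in F m.
Proof. by rewrite pi_canonical_map canonical_free1. Qed.

End Perfect.

(* canonical_map is natural in M and compatible with the right R_F-module
   structures, so it is a natural isomorphism if and only if each of its
   components is bijective. *)
Definition perfect (R : nzRingType) (F : gabriel_topology R) : Prop :=
  forall M : lmodType R^c, bijective (@canonical_map R F M).

(* Main.v *)
(* A four lemma modulo torsion: call y almost in a submodule N when
   {r | y r \in N} belongs to F.  The last axiom of a Gabriel topology makes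
   this notion idempotent, so y is almost in N as soon as y r is, for all r in
   some member of F.  The chase of the classical four lemma then goes through,
   each use of exactness or surjectivity being replaced by a passage from an
   element y to the elements y r. *)

Require Import Defs.
From mathcomp Require Import all_boot all_order all_algebra.
From mathcomp Require Import boolp classical_sets.

Set Implicit Arguments.
Unset Strict Implicit.
Unset Printing Implicit Defensive.

Import GRing.Theory.

Local Open Scope ring_scope.

Section AlmostIn.
Variables (R : nzRingType) (F : gabriel_topology R).

Definition almost_in (M : lmodType R^c) (N : submodClosed M) (y : M) : Prop :=
  F [set r : R | (r : R^c) *: y \in N]%classic.

Section Submodule.
Variables (M : lmodType R^c) (N : submodClosed M).

Lemma right_ideal_colon (y : M) :
  right_ideal [set r : R | (r : R^c) *: y \in N]%classic.
Proof.
split=> [|r s ry sy|r s ry] /=.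
- by rewrite scale0r; exact: (rpred0 N).
- rewrite (scalerDl y (r : R^c) s); exact: (rpredD (ry : _ \in N) sy).
- have := rpredZ (s : R^c) (ry : _ \in N).
  by rewrite scalerA.
Qed.

Lemma almost_in_witness (I : set R) (y : M) :
  F I -> (forall r : R, I r -> (r : R^c) *: y \in N) -> almost_in N y.
Proof. by move=> FI Iy; exact: gabriel_sub FI (right_ideal_colon y) Iy. Qed.

Lemma almost_inE (y : M) : almost_in N y ->
  exists2 I, F I & forall r : R, I r -> (r : R^c) *: y \in N.
Proof. by move=> yN; exists [set r : R | (r : R^c) *: y \in N]%classic. Qed.

Lemma almost_in_local (I : set R) (y : M) :
  F I -> (forall r : R, I r -> almost_in N ((r : R^c) *: y)) -> almost_in N y.
Proof.
move=> FI Iy; apply: (gabriel_local (right_ideal_colon y) FI) => r /Iy.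
(* The colon by [r] of the ideal attached to [y] is the ideal attached to [y r], because (y r) s = y
   (r s). *)
by congr (F _); apply/funext => s /=; rewrite scalerA.
Qed.

Lemma almost_inD (x y : M) :
  x \in N -> almost_in N y -> almost_in N (x + y).
Proof.
move=> xN yN; apply: almost_in_witness yN _ => r ry.
by rewrite scalerDr; exact: (rpredD (rpredZ _ xN) ry).
Qed.

(** An [r] kills the class of [y] exactly when y r lies in [N]; this translates [Fepi] and [Fexact]
    into [almost_in]. *)
Lemma torsion_quotmod : torsion F (quotmod N) -> forall y, almost_in N y.
Proof.
move=> tN y; have [I FI Iy] := tN (\pi_(quotmod N) y)%qT.
apply: almost_in_witness FI _ => r /Iy.
rewrite -[_ *: _]/(quotmod_scale _ _) pi_quotmod_scale => ry.
rewrite -[_ *: y]subr0; apply/quotmod_eqP.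
by rewrite ry raddf0.
Qed.

Lemma quotmod_torsion : (forall y, almost_in N y) -> torsion F (quotmod N).
Proof.
move=> Ny y; have [I FI Iy] := almost_inE (Ny (repr y)); exists I => // r /Iy ry.
rewrite -[_ *: _]/(quotmod_scale _ _) -[y in LHS]reprK pi_quotmod_scale.
rewrite -[RHS](raddf0 (\pi_(quotmod N))%qT).
by apply/quotmod_eqP; rewrite subr0.
Qed.

End Submodule.

(** View [y] as an element of [kermod g]: there [in_im_ker] unfolds to membership of the underlying
    element in the image of [f]. *)
Lemma Fexact_almost_im (A B C : lmodType R^c)
    (f : {linear A -> B}) (g : {linear B -> C}) (y : B) :
  Fexact F f g -> g y = 0 -> almost_in (in_im f) y.
Proof.
move=> [_ tH] /eqP gy.
exact: (torsion_quotmod tH (Kermod (gy : y \in in_ker g))).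
Qed.

End AlmostIn.

Theorem proposition4p3 (R : nzRingType) (F : gabriel_topology R)
    (F_stable : stable F) (F_perfect : perfect F)
    (A1 A2 A3 A4 B1 B2 B3 B4 : lmodType R^c)
    (f1 : {linear A1 -> A2}) (f2 : {linear A2 -> A3}) (f3 : {linear A3 -> A4})
    (g1 : {linear B1 -> B2}) (g2 : {linear B2 -> B3}) (g3 : {linear B3 -> B4})
    (t1 : {linear A1 -> B1}) (t2 : {linear A2 -> B2})
    (t3 : {linear A3 -> B3}) (t4 : {linear A4 -> B4})
    (f12_exact : Fexact F f1 f2) (f23_exact : Fexact F f2 f3)
    (g12_exact : Fexact F g1 g2) (g23_exact : Fexact F g2 g3)
    (tf1 : forall x, t2 (f1 x) = g1 (t1 x))
    (tf2 : forall x, t3 (f2 x) = g2 (t2 x))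
    (tf3 : forall x, t4 (f3 x) = g3 (t3 x)) :
  (Fepi F t1 -> Fepi F t3 -> injective t4 -> torsionfree F B2 -> Fepi F t2) /\
  (Fepi F t1 -> injective t2 -> injective t4 ->
     torsion F (kermod t3) /\ (torsionfree F A3 -> injective t3)).
Proof.
have im_ex (A B : lmodType R^c) (f : {linear A -> B}) y :
  y \in in_im f -> exists x, f x = y by move/asboolP.
split=> [t1_epi t3_epi t4_inj _|t1_epi t2_inj t4_inj].
  apply: quotmod_torsion => y.
  apply: (almost_in_local (torsion_quotmod t3_epi (g2 y))) => r /= /im_ex[a3 ea3].
  have fa3 : f3 a3 = 0.
    by apply: t4_inj; rewrite raddf0 tf3 ea3 linearZ /= g23_exact.1 scaler0.
  apply: (almost_in_local (Fexact_almost_im f23_exact fa3)) => s /= /im_ex[a2 ea2].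
  (* Here z = y r s, and both g2 z and g2 (t2 a2) equal t3 (a3 s). Correcting by t2 a2, which is in
     the target image, moves z into the kernel of [g2]. *)
  set z := _ *: (_ *: y).
  have gz : g2 (z - t2 a2) = 0.
    by rewrite raddfB /= -tf2 ea2 !linearZ /= ea3 -scalerDr subrr scaler0.
  rewrite -[z](subrKC (t2 a2)); apply: almost_inD.
    by apply/asboolP; exists a2.
  apply: (almost_in_local (Fexact_almost_im g12_exact gz)) => u /= /im_ex[b1 <-].
  (* If b1 v = t1 a1, then (g1 b1) v = g1 (t1 a1) = t2 (f1 a1). *)
  apply: almost_in_witness (torsion_quotmod t1_epi b1) _ => v /= /im_ex[a1 ea1].
  by apply/asboolP; exists (f1 a1); rewrite tf1 ea1 linearZ.
have ann a3 : t3 a3 = 0 -> annihilated F a3.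
  (* The kernel of the identity is the zero submodule, so being almost in [Z] means being
     annihilated by a member of [F]. *)
  move=> ta3; pose Z := in_ker (idfun : {linear A3 -> A3}).
  suff /almost_inE[I FI Ia3] : almost_in F Z a3 by exists I => // r /Ia3/eqP.
  have fa3 : f3 a3 = 0 by apply: t4_inj; rewrite raddf0 tf3 ta3 raddf0.
  apply: (almost_in_local (Fexact_almost_im f23_exact fa3)) => r /= /im_ex[a2 ea2].
  have ga2 : g2 (t2 a2) = 0 by rewrite -tf2 ea2 linearZ /= ta3 scaler0.
  rewrite -ea2.
  apply: (almost_in_local (Fexact_almost_im g12_exact ga2)) => s /= /im_ex[b1 eb1].
  apply: almost_in_witness (torsion_quotmod t1_epi b1) _ => u /= /im_ex[a1 ea1].
  (* Both sides have image (g1 b1) u under [t2]. Applying [f2] then gives (f2 a2) s u = f2 (f1 a1) =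
     0. *)
  have fa1 : f1 a1 = (u : R^c) *: ((s : R^c) *: a2).
    by apply: t2_inj; rewrite tf1 ea1 !linearZ /= eb1.
  by apply/eqP; rewrite /= -!linearZ -fa1 f12_exact.1.
split=> [[a3 ka3]|A3_tf x y txy].
  have [I FI Ia3] := ann a3 (eqP ka3); exists I => // r /Ia3 ra3.
  by apply: val_inj; rewrite linearZ.
apply/eqP; rewrite -subr_eq0; apply/eqP/A3_tf/ann.
by rewrite raddfB /= txy subrr.
Qed.
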